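(* Let $d\ge 2$ be an integer. (a) For any $0<\alpha<\infty$ there exist $C_1,C_2>0$ depending only on $d$ and $\alpha$ such that $$C_1(\min(1,v))^{2\alpha}\le G_\alpha(v)\le C_2(\min(1,v))^{2\alpha},\qquad v\ge 0.$$ (b) Consequently, for any $1\le p<\infty$ and any real $m>0$, with $p'=p/(p-1)$ ($p'=\infty$ if $p=1$), there exist $\tilde C_1,\tilde C_2>0$ depending only on $p,m,d$ such that $$\tilde C_1\Psi_{p',m}[g](t)\le\psi_{p',m}[g](t)\le\tilde C_2\Psi_{p',m}[g](t)$$ for all $g\in L^{p'}(\mathbb{R}^d)$ and all $t>0$.
   Context: $\mathbb{S}^{d-1}$ is the unit sphere in $\mathbb{R}^d$ with its standard surface measure $dS$. For $0<\alpha<\infty$ the function $G_\alpha:[0,\infty)\to[0,\infty)$ is defined by $$G_\alpha(|w|)=2^\alpha\int_{\mathbb{S}^{d-1}}\big(1-\cos(y\cdot w)\big)^\alpha\,dS_y,\qquad w\in\mathbb{R}^d$$ (the right-hand side depends only on $|w|$). For $g\in L^{p'}(\mathbb{R}^d)$ and $t>0$, the modified tail is $$\psi_{p',m}[g](t)=\Big(\int_{\mathbb{R}^d}\min\big(1,(|\xi|/t)^{mp'}\big)|g(\xi)|^{p'}\,d\xi\Big)^{1/p'}\ (p'<\infty),$$ $$\psi_{\infty,m}[g](t)=\sup_{\xi\in\mathbb{R}^d}\Big(\min\big(1,(|\xi|/t)^m\big)|g(\xi)|\Big)$$ (essential supremum), and the Bessel tail is $$\Psi_{p',m}[g](t)=\Big(\int_{\mathbb{R}^d}G_{mp'/2}(|\xi|/t)\,|g(\xi)|^{p'}\,d\xi\Big)^{1/p'}\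 (p'<\infty),\qquad \Psi_{\infty,m}[g](t)=\psi_{\infty,m}[g](t).$$ *)

(* Defs.v *)
From HB Require Import structures.
From mathcomp Require Import all_boot all_order all_algebra.
From mathcomp Require Import complex.
From mathcomp Require Import all_classical all_reals all_analysis.
From mathcomp Require Import measurable_realfun ess_sup_inf.

Set Implicit Arguments.
Unset Strict Implicit.
Unset Printing Implicit Defensive.

Import Order.TTheory GRing.Theory Num.Theory.
Import numFieldNormedType.Exports.

Local Open Scope classical_set_scope.
Local Open Scope ring_scope.

(* R^d is d.-tuple R, whose canonical sigma-algebra is the product (Borel)
   one. *)

Section euclidean.
Context {R : realType} {d : nat}.
Implicit Types x y : d.-tuple R.

Definition dot x y : R := \sum_(i < d) tnth x i * tnth y i.

Definition enorm x : R := Num.sqrt (dot x x).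

Definition scalev (a : R) x : d.-tuple R := [tuple a * tnth x i | i < d].

(* (1, 0, ..., 0) *)
Definition axis0 : d.-tuple R := [tuple (i == 0%N :> nat)%:R | i < d].

Lemma measurable_enorm : measurable_fun setT enorm.
Proof.
have msqrt : measurable_fun setT (@Num.sqrt R).
  by apply: continuous_measurable_fun; exact: sqrt_continuous.
apply: (measurableT_comp msqrt); apply: measurable_sum => i.
by apply: measurable_funM; exact: measurable_tnth.
Qed.

Lemma measurable_radial_proj :
  measurable_fun setT (fun x => scalev (enorm x)^-1 x).
Proof.
apply/measurable_fun_tnthP => i /=.
rewrite (_ : _ \o _ =
  ((fun r => r `^ (-1)) \o enorm) \* (@tnth d R ^~ i)); last first.
  by apply/funext => x /=; rewrite tnth_mktuple powR_inv1// sqrtr_ge0.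
apply: measurable_funM; last exact: measurable_tnth.
by apply: measurableT_comp measurable_enorm; exact: measurable_powR.
Qed.

End euclidean.
Arguments axis0 {R d}.

(* Lebesgue measure on R^n, by slicing along the first coordinate. *)
Fixpoint lebesgue {R : realType} (n : nat) : set (n.-tuple R) -> \bar R :=
  match n with
  | 0 => \d_([tuple] : 0.-tuple R)
  | m.+1 => fun A => (\int[lebesgue_measure]_x
      lebesgue [set t : m.-tuple R | A [tuple of x :: t]])%E
  end.
Arguments lebesgue {R} n.

Section lebesgue_is_measure.
Context {R : realType}.

Let consf n (z : measurableTypeR R * n.-tuple R) : n.+1.-tuple R :=
  [tuple of z.1 :: z.2].

Let measurable_consf n : measurable_fun setT (@consf n).
Proof.
apply: (@measurable_cons _ _ _ R) => //.
Qed.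

Let measurable_thead n :
  measurable_fun setT (@thead n R : n.+1.-tuple R -> measurableTypeR R).
Proof. exact: (@measurable_tnth _ R n.+1 ord0). Qed.

Lemma lebesgue_sigma_finite_measure n :
  exists m : {sigma_finite_measure set (n.-tuple R) -> \bar R},
    lebesgue n = m.
Proof.
elim: n => [|n [m IH]].
  pose D : {sigma_finite_measure set (0.-tuple R) -> \bar R} :=
    \d_([tuple] : 0.-tuple R).
  by exists D.
pose mu : {sigma_finite_measure set (measurableTypeR R) -> \bar R} :=
  @lebesgue_measure R.
pose P : {measure set (measurableTypeR R * n.-tuple R) -> \bar R} := (mu \x m)%E.
pose Q : {measure set (n.+1.-tuple R) -> \bar R} :=
  measure_function_pushforward__canonical__measure_function_Measure
    P (@measurable_consf n).
have sQ : sigma_finite setT Q.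
  have /sigma_finiteP[F [TF ndF Foo]] := sigma_finiteT mu.
  have /sigma_finiteP[G [TG ndG Goo]] := sigma_finiteT m.
  pose g (t : n.+1.-tuple R) : measurableTypeR R * n.-tuple R :=
    (thead t, [tuple of behead t]).
  have mg : measurable_fun setT g.
    apply: (measurable_fun_pair (@measurable_thead n)).
    exact: measurable_behead.
  have gK : cancel (@consf n) g.
    by move=> [x t]; rewrite /g /consf /= theadE; congr pair; exact: val_inj.
  exists (fun k => g @^-1` (F k `*` G k)).
    apply/seteqP; split => // t _.
    have [k _ Fk] : (\bigcup_k F k) (g t).1 by rewrite -TF.
    have [l _ Gl] : (\bigcup_k G k) (g t).2 by rewrite -TG.
    exists (maxn k l) => //; split.
      by move: (g t).1 Fk; exact/subsetPset/ndF/leq_maxl.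
    by move: (g t).2 Gl; exact/subsetPset/ndG/leq_maxr.
  move=> k; have [mF Fk] := Foo k; have [mG Gk] := Goo k; split.
    by rewrite -[X in measurable X]setTI; apply: mg => //; exact: measurableX.
  have -> : Q (g @^-1` (F k `*` G k)) = P (F k `*` G k).
    rewrite /Q /= /pushforward; congr (_ _).
    by apply/funext => z; rewrite /preimage /mkset gK.
  rewrite /P /=.
  by rewrite product_measure1E// lte_mul_pinfty// ge0_fin_numE.
pose S : {sigma_finite_measure set (n.+1.-tuple R) -> \bar R} :=
  HB.pack (Q : set (n.+1.-tuple R) -> \bar R)
    (Measure.class Q) (@Measure_isSigmaFinite.Build _ _ _ Q sQ).
exists S; apply/funext => A /=.
rewrite /pushforward /P /= /product_measure1.
apply: eq_integral => x _; rewrite IH /=; congr (m _).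
by apply/seteqP; split => t; rewrite /xsection/= inE.
Qed.

Let lebesgue0 n : @lebesgue R n set0 = 0%E.
Proof. by have [m ->] := lebesgue_sigma_finite_measure n; exact: measure0. Qed.

Let lebesgue_ge0 n A : (0 <= @lebesgue R n A)%E.
Proof.
by have [m ->] := lebesgue_sigma_finite_measure n; exact: measure_ge0.
Qed.

Let lebesgue_semi_sigma_additive n : semi_sigma_additive (@lebesgue R n).
Proof.
have [m ->] := lebesgue_sigma_finite_measure n.
exact: measure_semi_sigma_additive.
Qed.

Let lebesgue_sigma_finite n : sigma_finite setT (@lebesgue R n).
Proof.
by have [m ->] := lebesgue_sigma_finite_measure n; exact: sigma_finiteT.
Qed.

HB.instance Definition _ n := isMeasure.Build _ _ _ (@lebesgue R n)
  (lebesgue0 n) (@lebesgue_ge0 n) (@lebesgue_semi_sigma_additive n).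

HB.instance Definition _ n := @Measure_isSigmaFinite.Build _ _ _
  (@lebesgue R n) (@lebesgue_sigma_finite n).

End lebesgue_is_measure.

Section surface_measure.
Context {R : realType} (d : nat).

Definition sphere : set (d.-tuple R) := [set y | enorm y = 1].

(* The union of the segments ]0, y] for y in A `&` sphere. *)
Definition cone (A : set (d.-tuple R)) : set (d.-tuple R) :=
  [set x | 0 < enorm x <= 1 /\ A (scalev (enorm x)^-1 x)].

(* Surface measure of A `&` sphere: d times the volume of the cone over it,
   i.e. the factor dS of Lebesgue measure in polar coordinates
   dx = r ^ (d - 1) dr dS.  As a measure on R^d it is carried by the sphere. *)
Definition surface (A : set (d.-tuple R)) : \bar R :=
  (d%:R%:E * lebesgue d (cone A))%E.

Let ball0 : set (d.-tuple R) := [set x | 0 < enorm x <= 1].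

Let measurable_ball0 : measurable ball0.
Proof.
rewrite (_ : ball0 = enorm @^-1` `]0, 1]).
  by rewrite -[X in measurable X]setTI; exact: measurable_enorm.
by apply/seteqP; split => x /=; rewrite in_itv.
Qed.

Let nu : {measure set (d.-tuple R) -> \bar R} :=
  measure_function_pushforward__canonical__measure_function_Measure
    (mrestr (@lebesgue R d) measurable_ball0) (@measurable_radial_proj R d).

Let surfaceE : surface = mscale (d%:R)%:nng nu.
Proof.
apply/funext => A; rewrite /surface /mscale /nu /= /pushforward /mrestr.
by congr (_ * lebesgue d _)%E; apply/seteqP; split => x [].
Qed.

Let surface0 : surface set0 = 0%E.
Proof. by rewrite surfaceE measure0. Qed.

Let surface_ge0 A : (0 <= surface A)%E.
Proof. by rewrite surfaceE; exact: measure_ge0. Qed.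

Let surface_semi_sigma_additive : semi_sigma_additive surface.
Proof. by rewrite surfaceE; exact: measure_semi_sigma_additive. Qed.

HB.instance Definition _ := isMeasure.Build _ _ _ surface
  surface0 surface_ge0 surface_semi_sigma_additive.

End surface_measure.
Arguments sphere {R} d.
Arguments surface {R} d.

Section tails.
Context {R : realType} {d : nat}.
Implicit Types (g : d.-tuple R -> R[i]) (q : \bar R) (w : d.-tuple R).

Definition sphere_integral (alpha : R) w : R :=
  2 `^ alpha *
  \int[surface d]_(y in sphere d) (1 - cos (dot y w)) `^ alpha.

(* sphere_integral alpha w depends only on enorm w; the representative of norm
   v is v e_1.  The integrand is bounded and surface d is finite, so the
   real-valued integral is the true one. *)
Definition G (alpha v : R) : R := sphere_integral alpha (scalev v axis0).

Definition Cabs g xi : R := ComplexField.Normc.normc (g xi).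

Definition in_Lp q g : Prop :=
  [/\ measurable_fun setT (fun xi => complex.Re (g xi)),
      measurable_fun setT (fun xi => complex.Im (g xi)) &
      ('N[lebesgue d]_q[EFin \o Cabs g] < +oo)%E].

(* The tails are used for q in ]1, +oo] only; -oo gets a junk value. *)
Definition mod_tail q (m : R) g (t : R) : \bar R :=
  match q with
  | r%:E => ((\int[lebesgue d]_xi
      (Num.min 1 ((enorm xi / t) `^ (m * r)) * Cabs g xi `^ r)%:E) `^ r^-1)%E
  | +oo%E => ess_sup (lebesgue d)
      (fun xi => (Num.min 1 ((enorm xi / t) `^ m) * Cabs g xi)%:E)
  | -oo%E => 0%E
  end.

Definition Bessel_tail q (m : R) g (t : R) : \bar R :=
  match q with
  | r%:E => ((\int[lebesgue d]_xi
      (G (m * r / 2) (enorm xi / t) * Cabs g xi `^ r)%:E) `^ r^-1)%E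
  | _ => mod_tail q m g t
  end.

End tails.
Arguments G {R} d alpha v.

Definition conj_exp {R : realType} (p : R) : \bar R :=
  if p == 1 then +oo%E else (p / (p - 1))%:E.

(* Main.v *)
Require Import Defs.
From mathcomp Require Import all_boot all_order all_algebra.
From mathcomp Require Import complex.
From mathcomp Require Import all_classical all_reals all_analysis.
From mathcomp Require Import measurable_realfun ring lra.

Set Implicit Arguments.
Unset Strict Implicit.
Unset Printing Implicit Defensive.

Import Order.TTheory GRing.Theory Num.Theory.
Import numFieldNormedType.Exports.
Local Open Scope classical_set_scope.
Local Open Scope ring_scope.

(** Write h x = 1 - cos x, and for a vector w of the plane of the first two
coordinates let F(w) be the integral of h(y . w) ^ alpha over the unit sphere,
so that G v = 2 ^ alpha F(v e_1).

The upper bound is pointwise: |y . v e_1| <= v on the sphere, and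
h x <= min(2, x^2 / 2) <= 2 min(1, v)^2 whenever |x| <= v.

For the lower bound, two inequalities compare F(v e_1) with F(e_1), which is
positive ([plane_G1_gt0]).
- h(x + y) <= 2 (h x + h y), because h x = |e^{ix} - 1|^2 / 2 and
  e^{i(x+y)} - 1 = e^{ix} (e^{iy} - 1) + (e^{ix} - 1).  Hence F is quasi-additive:
  F(w + w') <= 4 ^ alpha (F(w) + F(w')) ([plane_GD]).  If v >= 1/2, then e_1 is
  a sum of two vectors of norm v of the plane, (1/2, s) and (1/2, -s), and F is
  invariant under rotations of the plane, so F(e_1) <= 2 * 4 ^ alpha F(v e_1)
  ([plane_G1_le]).  This is where d >= 2 enters: in dimension 1, F vanishes at
  every multiple of 2 pi.
- h(2x) <= 4 h x, so F(2w) <= 4 ^ alpha F(w) ([plane_G_double]).  A vector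
  shorter than 1/2 is doubled until its norm is at least 1/2, and each doubling
  costs exactly the factor 4 ^ alpha = 2 ^ (2 alpha) by which v ^ (2 alpha) grows.

Rotation invariance ([plane_G_rotation]) comes from that of Lebesgue measure.
A plane rotation is a product of three shears, and a shear preserves Lebesgue
measure by Tonelli's theorem and translation invariance on the line.

The comparison of the tails follows by integrating the bounds on G, with
alpha = m p' / 2 and v = |xi| / t, against |g| ^ p' and taking the root of
order p'.  For p = 1 the two tails are
the same by definition. *)

(** * Inequalities for 1 - cos *)

(** The difference of the two sides is half of |e^{ix} + e^{-iy} - 2|^2. *)
Lemma one_sub_cosD (R : realType) (x y : R) :
  1 - cos (x + y) <= 2 * ((1 - cos x) + (1 - cos y)).
Proof.
rewrite cosD; have := cos2Dsin2 x; have := cos2Dsin2 y.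
have := sqr_ge0 (cos x + cos y - 2); have := sqr_ge0 (sin x - sin y).
nra.
Qed.

Lemma one_sub_cos_ge0 (R : realType) (x : R) : 0 <= 1 - cos x.
Proof. by rewrite subr_ge0 cos_le1. Qed.

Lemma norm_sin_le (R : realType) (x : R) : `|sin x| <= `|x|.
Proof.
wlog x0 : x / 0 <= x => [h|].
  have [/h//|/ltW x0] := leP 0 x.
  by rewrite -normrN -sinN -[leRHS]normrN h// oppr_ge0.
have D z : z \in `]0, x[ -> is_derive z 1 sin (cos z).
  by move=> _; exact: is_derive_sin.
have C : {within `[0, x], continuous sin}.
  by apply: continuous_subspaceT => z; exact: continuous_sin.
have [c _] := MVT_segment x0 D C.
rewrite sin0 !subr0 => ->.
by rewrite normrM ler_piMl// cos_max.
Qed.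

(** Beyond v = 1 only the trivial bound 2 is available; below it, the half-angle
formula 1 - cos x = 2 sin (x / 2) ^ 2 makes the bound quadratic. *)
Lemma one_sub_cos_le (R : realType) (x v : R) : 0 <= v -> `|x| <= v ->
  1 - cos x <= 2 * Num.min 1 v ^+ 2.
Proof.
move=> v0 xv.
have [v1|v1] := leP 1 v.
  by rewrite expr1n mulr1; have := cos_geN1 x; lra.
have -> : cos x = 1 - sin (x / 2) ^+ 2 *+ 2.
  by rewrite [in LHS](splitr x) cosD -!expr2 cos2sin2 mulr2n; ring.
have : sin (x / 2) ^+ 2 <= v ^+ 2.
  rewrite -real_normK ?num_real// ler_pXn2r ?nnegrE//.
  have := norm_sin_le (x / 2).
  rewrite normrM [`|2^-1|]ger0_norm ?invr_ge0//.
  by have := normr_ge0 x; lra.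
by rewrite mulr2n; lra.
Qed.

(** The sum a + b is at most twice the larger term; this covers al < 1 and al >= 1
alike. *)
Lemma powRD_le (R : realType) (a b al : R) : 0 < al -> 0 <= a -> 0 <= b ->
  (a + b) `^ al <= 2 `^ al * (a `^ al + b `^ al).
Proof.
move=> al0; wlog ab : a b / a <= b => [h a0 b0|a0 b0].
  have [/h|/ltW/h] := leP a b; first exact.
  by rewrite addrC [X in _ * X]addrC; exact.
apply: (@le_trans _ _ ((2 * b) `^ al)).
  by rewrite ge0_ler_powR ?nnegrE ?addr_ge0 ?mulr_ge0 ?(ltW al0)//; lra.
by rewrite powRM// ler_wpM2l ?powR_ge0// lerDr powR_ge0.
Qed.

Lemma one_sub_cos_powD (R : realType) (x y al : R) : 0 < al ->
  (1 - cos (x + y)) `^ al <=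
  4 `^ al * ((1 - cos x) `^ al + (1 - cos y) `^ al).
Proof.
move=> al0; have [x0 y0] := (one_sub_cos_ge0 x, one_sub_cos_ge0 y).
have -> : 4 `^ al = 2 `^ al * 2 `^ al :> R by rewrite -powRM//; congr powR; ring.
rewrite -mulrA; apply: le_trans (ler_wpM2l (powR_ge0 _ _) (powRD_le al0 x0 y0)).
rewrite -powRM; [|by []|exact: addr_ge0].
apply: ge0_ler_powR; rewrite ?nnegrE ?(ltW al0) ?one_sub_cos_ge0//.
exact: one_sub_cosD.
Qed.

(** * Plane rotations preserve Lebesgue measure *)

Lemma lebesgue_measure_translate (R : realType) (a : R) (A : set R) :
  measurable A ->
  lebesgue_measure ((fun y => a + y) @^-1` A) = lebesgue_measure A.
Proof.
move=> mA; apply/esym.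
have mf : measurable_fun setT ((fun y => a + y) : _ -> measurableTypeR R).
  by apply: measurable_funD.
apply: (@lebesgue_measure_unique R
  (measure_function_pushforward__canonical__measure_function_Measure
    lebesgue_measure mf)) => //= _ [[b c]] _ <-.
rewrite /pushforward/=.
have -> : (fun y => a + y) @^-1` `]b, c] = `]b - a, c - a]%classic.
  by apply/seteqP; split => y /=; rewrite !in_itv/=; lra.
rewrite !lebesgue_measure_itv/= !lte_fin ltrD2r.
by case: ifPn => // _; congr EFin; ring.
Qed.

Lemma ge0_integral_translate (R : realType) (a : R)
    (f : measurableTypeR R -> \bar R) :
  measurable_fun setT f -> (forall y, 0 <= f y)%E ->
  (\int[lebesgue_measure]_y f (a + y)%R = \int[lebesgue_measure]_y f y)%E.
Proof.
move=> mf f0.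
have mt : measurable_fun setT
    ((fun y => a + y) : measurableTypeR R -> measurableTypeR R).
  by apply: measurable_funD.
have f0' : {in setT, forall y, 0 <= f y}%E by [].
rewrite -[LHS](ge0_integral_pushforward mt lebesgue_measure measurableT mf f0').
by apply: eq_measure_integral => A mA _; exact: lebesgue_measure_translate.
Qed.

(** The linear map acting by the matrix ((a, b), (c, e)) on the first two
coordinates and by the identity on the others. *)
Definition plane_map {R : realType} {n} (a b c e : R) (z : n.+2.-tuple R) :
    n.+2.-tuple R :=
  [tuple of a * tnth z ord0 + b * tnth z (lift ord0 ord0) ::
   [tuple of c * tnth z ord0 + e * tnth z (lift ord0 ord0) ::
    [tuple of behead [tuple of behead z]]]].

Lemma measurable_plane_map (R : realType) n (a b c e : R) :
  measurable_fun setT (@plane_map R n a b c e).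
Proof.
apply: (@measurable_cons _ _ _ R).
  by apply: measurable_funD; apply: measurable_funM => //; exact: measurable_tnth.
apply: (@measurable_cons _ _ _ R).
  by apply: measurable_funD; apply: measurable_funM => //; exact: measurable_tnth.
exact: (measurableT_comp (@measurable_behead _ R n)
  (@measurable_behead _ R n.+1)).
Qed.

(** The density that remains once all coordinates but the first two are
integrated out: in terms of it, plane maps act on the arguments (x, y) alone
([plane_slice_plane_map]). *)
Definition plane_slice {R : realType} {n} (A : set (n.+2.-tuple R))
    (z : measurableTypeR R * measurableTypeR R) : \bar R :=
  lebesgue n [set r : n.-tuple R |
    A [tuple of (z.1 : R) :: [tuple of (z.2 : R) :: r]]].

Lemma lebesgue_plane_slice (R : realType) n (A : set (n.+2.-tuple R)) :
  lebesgue n.+2 A = (\int[lebesgue_measure]_x \int[lebesgue_measure]_y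
    plane_slice A (x, y))%E.
Proof. by []. Qed.

Lemma measurable_plane_slice (R : realType) n (A : set (n.+2.-tuple R)) :
  measurable A -> measurable_fun setT (plane_slice A).
Proof.
move=> mA.
pose f (z : (measurableTypeR R * measurableTypeR R) * n.-tuple R) :
    n.+2.-tuple R :=
  [tuple of (z.1.1 : R) :: [tuple of (z.1.2 : R) :: z.2]].
have mf : measurable_fun setT f.
  apply: (@measurable_cons _ _ _ R).
    by apply: measurableT_comp.
  apply: (@measurable_cons _ _ _ R) => //.
  by apply: measurableT_comp.
have mfA : measurable (f @^-1` A) by rewrite -[X in measurable X]setTI; exact: mf.
have -> : plane_slice A = lebesgue n \o xsection (f @^-1` A).
  apply/funext => z; rewrite /plane_slice /=; congr (lebesgue n _).
  by apply/seteqP; split => r; rewrite /xsection/= inE.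
exact: measurable_fun_xsection.
Qed.

Lemma plane_slice_ge0 (R : realType) n (A : set (n.+2.-tuple R)) z :
  (0 <= plane_slice A z)%E.
Proof. exact: measure_ge0. Qed.

Lemma plane_slice_plane_map (R : realType) n (a b c e : R)
    (A : set (n.+2.-tuple R)) (x y : R) :
  plane_slice (plane_map a b c e @^-1` A) (x, y) =
  plane_slice A (a * x + b * y, c * x + e * y).
Proof.
rewrite /plane_slice; congr (lebesgue n _); apply/seteqP.
have E (r : n.-tuple R) : plane_map a b c e [tuple of x :: [tuple of y :: r]] =
    [tuple of a * x + b * y :: [tuple of c * x + e * y :: r]].
  by apply/val_inj => /=; rewrite !(tnth_nth 0).
by split => r /=; rewrite E.
Qed.

(** The innermost of the two iterated integrals is over the second coordinate, so
for each fixed x this shear is a translation by t * x. *)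
Lemma lebesgue_shear_snd (R : realType) n (t : R) (A : set (n.+2.-tuple R)) :
  measurable A ->
  lebesgue n.+2 (plane_map 1 0 t 1 @^-1` A) = lebesgue n.+2 A.
Proof.
move=> mA; rewrite !lebesgue_plane_slice; apply: eq_integral => x _.
under eq_integral do rewrite plane_slice_plane_map !mul1r mul0r addr0.
apply: (@ge0_integral_translate R _ (fun y => plane_slice A (x, y))).
  by apply: measurableT_comp (measurable_plane_slice mA) _.
by move=> y; exact: plane_slice_ge0.
Qed.

(** Exchanging the order of integration makes this shear a translation for each
fixed y. *)
Lemma lebesgue_shear_fst (R : realType) n (t : R) (A : set (n.+2.-tuple R)) :
  measurable A ->
  lebesgue n.+2 (plane_map 1 t 0 1 @^-1` A) = lebesgue n.+2 A.
Proof.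
move=> mA; have mU : measurable (plane_map 1 t 0 1 @^-1` A).
  by rewrite -[X in measurable X]setTI; exact: measurable_plane_map.
rewrite !lebesgue_plane_slice.
rewrite (fubini_tonelli _ (measurable_plane_slice mU) (plane_slice_ge0 _)).
rewrite (fubini_tonelli _ (measurable_plane_slice mA) (plane_slice_ge0 _)).
apply: eq_integral => y _.
under eq_integral do
  rewrite plane_slice_plane_map !mul1r mul0r add0r addrC.
apply: (@ge0_integral_translate R _ (fun x => plane_slice A (x, y))).
  by apply: measurableT_comp (measurable_plane_slice mA) _.
by move=> x; exact: plane_slice_ge0.
Qed.

Lemma plane_map_comp (R : realType) n (a b c e a' b' c' e' : R) :
  @plane_map R n a b c e \o plane_map a' b' c' e' =
  plane_map (a * a' + b * c') (a * b' + b * e')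
            (c * a' + e * c') (c * b' + e * e').
Proof.
apply/funext => z; apply/val_inj => /=.
rewrite !(tnth_nth 0)/= !(tnth_nth 0)/=; congr [:: _, _ & _]; ring.
Qed.

(** With c = cos theta and s = sin theta, t is - tan (theta / 2).  The hypothesis
excludes the half-turn, for which the tangent is infinite. *)
Lemma rotation_shears (R : realType) n (c s : R) : 1 + c != 0 ->
  c ^+ 2 + s ^+ 2 = 1 ->
  let t := - (s / (1 + c)) in
  @plane_map R n c (- s) s c =
  plane_map 1 t 0 1 \o (plane_map 1 0 s 1 \o plane_map 1 t 0 1).
Proof.
move=> c1 cs t; rewrite !plane_map_comp /t.
have ts : s / (1 + c) * s = 1 - c.
  by apply: (mulIf c1); rewrite mulrAC divfK//; lra.
have tc : s / (1 + c) * (1 + c) = s by rewrite divfK.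
by congr plane_map; nra.
Qed.

Lemma lebesgue_rotation (R : realType) n (c s : R) (A : set (n.+2.-tuple R)) :
  1 + c != 0 -> c ^+ 2 + s ^+ 2 = 1 -> measurable A ->
  lebesgue n.+2 (plane_map c (- s) s c @^-1` A) = lebesgue n.+2 A.
Proof.
move=> c1 cs mA.
have mP (a b c' e : R) (B : set (n.+2.-tuple R)) : measurable B ->
    measurable (plane_map a b c' e @^-1` B).
  by move=> mB; rewrite -[X in measurable X]setTI; exact: measurable_plane_map.
rewrite (rotation_shears n c1 cs); set t := - (s / (1 + c)).
have mA1 := mP 1 t 0 1 _ mA.
have mA2 := mP 1 0 s 1 _ mA1.
rewrite -(lebesgue_shear_fst t mA) -(lebesgue_shear_snd s mA1).
exact: (lebesgue_shear_fst t mA2).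
Qed.

(** * Surface measure of the sphere *)

Lemma tnth_plane_map0 (R : realType) n (a b c e : R) (z : n.+2.-tuple R) :
  tnth (plane_map a b c e z) ord0 =
  a * tnth z ord0 + b * tnth z (lift ord0 ord0).
Proof. by []. Qed.

Lemma tnth_plane_map1 (R : realType) n (a b c e : R) (z : n.+2.-tuple R) :
  tnth (plane_map a b c e z) (lift ord0 ord0) =
  c * tnth z ord0 + e * tnth z (lift ord0 ord0).
Proof. by []. Qed.

Lemma tnth_plane_map2 (R : realType) n (a b c e : R) (z : n.+2.-tuple R) i :
  tnth (plane_map a b c e z) (lift ord0 (lift ord0 i)) =
  tnth z (lift ord0 (lift ord0 i)).
Proof. by rewrite !(tnth_nth 0)/= !nth_behead. Qed.

Lemma enorm_rotation (R : realType) n (c s : R) (z : n.+2.-tuple R) :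
  c ^+ 2 + s ^+ 2 = 1 -> enorm (plane_map c (- s) s c z) = enorm z.
Proof.
move=> cs; rewrite /enorm /dot !big_ord_recl.
under eq_bigr do rewrite tnth_plane_map2.
rewrite tnth_plane_map0 tnth_plane_map1 !addrA; congr (Num.sqrt (_ + _)).
set p := tnth z _; set q := tnth z _.
have -> : (c * p + - s * q) * (c * p + - s * q) +
    (s * p + c * q) * (s * p + c * q) =
    (c ^+ 2 + s ^+ 2) * (p * p + q * q) by ring.
by rewrite cs mul1r.
Qed.

Lemma scalev_plane_map (R : realType) n (a b c e r : R) (z : n.+2.-tuple R) :
  scalev r (plane_map a b c e z) = plane_map a b c e (scalev r z).
Proof.
apply: eq_from_tnth => i; rewrite tnth_mktuple.
case: (unliftP ord0 i) => [j ->|->]; last first.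
  by rewrite !tnth_plane_map0 !tnth_mktuple; ring.
case: (unliftP ord0 j) => [k ->|->].
  by rewrite !tnth_plane_map2 tnth_mktuple.
by rewrite !tnth_plane_map1 !tnth_mktuple; ring.
Qed.

Lemma measurable_cone (R : realType) d (A : set (d.-tuple R)) :
  measurable A -> measurable (cone A).
Proof.
move=> mA.
have -> : cone A = enorm @^-1` `]0, 1] `&`
    (fun x => scalev (enorm x)^-1 x) @^-1` A.
  by apply/seteqP; split => x /=; rewrite /cone/= in_itv.
apply: measurableI; rewrite -[X in measurable X]setTI.
  exact: measurable_enorm.
exact: measurable_radial_proj.
Qed.

(** A linear isometry commutes with the formation of cones over subsets of the
sphere. *)
Lemma surface_rotation (R : realType) n (c s : R) (A : set (n.+2.-tuple R)) :
  1 + c != 0 -> c ^+ 2 + s ^+ 2 = 1 -> measurable A ->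
  surface n.+2 (plane_map c (- s) s c @^-1` A) = surface n.+2 A.
Proof.
move=> c1 cs mA; rewrite /surface.
rewrite -(lebesgue_rotation c1 cs (measurable_cone mA)).
congr (_ * lebesgue _ _)%E; apply/seteqP.
by split => x; rewrite /cone /preimage /= enorm_rotation// scalev_plane_map.
Qed.

Lemma measurable_sphere (R : realType) d : measurable (@sphere R d).
Proof.
rewrite (_ : sphere d = enorm @^-1` [set 1])//.
by rewrite -[X in measurable X]setTI; exact: measurable_enorm.
Qed.

Definition cube {R : realType} d (a b : R) : set (d.-tuple R) :=
  [set t | forall i, a <= tnth t i <= b].
Arguments cube {R} d a b.

Lemma measurable_cube (R : realType) d (a b : R) : measurable (cube d a b).
Proof.
rewrite (_ : cube d a b =
    \bigcap_(i in [set: 'I_d]) (@tnth d R ^~ i @^-1` `[a, b])).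
  apply: fin_bigcap_measurable => //.
  move=> i _; rewrite -[X in measurable X]setTI.
  by apply: measurable_tnth.
apply/seteqP; split => t /=.
  by move=> h i _ /=; rewrite in_itv/=.
by move=> h i; have := h i Logic.I; rewrite /= in_itv.
Qed.

Lemma lebesgue_cube (R : realType) d (a b : R) : a <= b ->
  lebesgue d (cube d a b) = ((b - a) ^+ d)%:E.
Proof.
move=> ab; elim: d => [|d IH].
  by rewrite /= diracE mem_set// => -[].
rewrite /= exprSr.
transitivity (\int[lebesgue_measure]_(x in `[a, b]) (cst ((b - a) ^+ d)%:E x))%E;
  last first.
  rewrite integral_cst//= lebesgue_measure_itv/= lte_fin.
  case: ltgtP ab => [_ _|//|-> _]; first by rewrite -EFinM.
  by rewrite mule0 subrr mulr0.
rewrite [RHS]integral_mkcond; apply: eq_integral => x _.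
rewrite patchE; case: ifPn => [|] xab.
  rewrite -IH; congr (lebesgue d _); apply/seteqP; split => t /= h i.
    by have := h (lift ord0 i); rewrite (tnth_nth 0)/= -(tnth_nth 0).
  case: (unliftP ord0 i) => [j ->|->].
    by rewrite (tnth_nth 0)/= -(tnth_nth 0).
  by move: xab; rewrite inE/= in_itv.
rewrite (_ : [set t | _] = set0) ?measure0//.
apply/seteqP; split => // t /= h; move: xab; apply/negP; rewrite negbK.
by rewrite inE/= in_itv; exact: (h ord0).
Qed.

Lemma norm_tnth_le (R : realType) d (y : d.-tuple R) i : `|tnth y i| <= enorm y.
Proof.
rewrite /enorm -sqrtr_sqr ler_wsqrtr// expr2 /dot (bigD1 i)//= lerDl.
by apply: sumr_ge0 => j _; rewrite -expr2 sqr_ge0.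
Qed.

(** Every cone lies in the unit ball, hence in the cube of side 2. *)
Lemma surface_lty (R : realType) d (A : set (d.-tuple R)) : measurable A ->
  (surface d A < +oo)%E.
Proof.
move=> mA; rewrite /surface.
have h : (lebesgue d (cone A) <= lebesgue d (cube d (-1) 1))%E.
  apply: le_measure; rewrite ?inE; first exact: measurable_cone.
    exact: measurable_cube.
  move=> x [/andP[_ x1] _] i; rewrite -ler_norml.
  exact: le_trans (norm_tnth_le _ _) x1.
apply: le_lt_trans (lee_wpmul2l _ h) _; first by rewrite lee_fin.
by rewrite lebesgue_cube -?EFinM ?ltry//; lra.
Qed.

Lemma integrable_sphere (R : realType) d (f : d.-tuple R -> R) (M : R) :
  measurable_fun setT f -> (forall y, 0 <= f y <= M) ->
  (surface d).-integrable (sphere d) (EFin \o f).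
Proof.
move=> mf fM; have mS := @measurable_sphere R d.
apply: (measurable_bounded_integrable mS (surface_lty mS)).
  exact: measurable_funS mf.
exists M; split; first exact: num_real.
move=> x Mx y _; apply: le_trans (ltW Mx).
by have /andP[f0 fy] := fM y; rewrite ger0_norm.
Qed.

(** * Two-sided bounds on G *)

(** [G] without the factor 2 ^ al, at the vector (a, b, 0, ..., 0) instead of
(v, 0, ..., 0): leaving the axis is what lets quasi-additivity and rotations
act. *)
Definition plane_G {R : realType} {n} (al a b : R) : R :=
  \int[surface n.+2]_(y in sphere n.+2)
    (1 - cos (a * tnth y ord0 + b * tnth y (lift ord0 ord0))) `^ al.

Lemma G_plane_G (R : realType) n (al v : R) :
  G n.+2 al v = 2 `^ al * @plane_G R n al v 0.
Proof.
apply: (congr1 (fun I => 2 `^ al * I)).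
apply: eq_Rintegral => y _; congr ((1 - cos _) `^ _).
rewrite /dot !big_ord_recl big1 => [|i _]; rewrite !tnth_mktuple/= ?mulr0//.
ring.
Qed.

Lemma measurable_plane_form (R : realType) n (a b : R) :
  measurable_fun setT (fun y : n.+2.-tuple R =>
    a * tnth y ord0 + b * tnth y (lift ord0 ord0)).
Proof.
by apply: measurable_funD; apply: measurable_funM => //; exact: measurable_tnth.
Qed.

Lemma measurable_one_sub_cos_pow (R : realType) d (T : measurableType d)
    (al : R) (f : T -> R) : measurable_fun setT f ->
  measurable_fun setT (fun y => (1 - cos (f y)) `^ al).
Proof.
move=> mf; apply: (measurableT_comp (measurable_powR _)).
apply: measurable_funB => //; apply: (measurableT_comp _ mf).
by apply: continuous_measurable_fun; exact: continuous_cos.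
Qed.

Lemma one_sub_cos_pow_le2 (R : realType) (al x : R) : 0 < al ->
  0 <= (1 - cos x) `^ al <= 2 `^ al.
Proof.
move=> al0; rewrite powR_ge0/=.
apply: ge0_ler_powR; rewrite ?nnegrE ?one_sub_cos_ge0 ?(ltW al0)//.
by have := cos_geN1 x; lra.
Qed.

Lemma integrable_plane_form (R : realType) n (al a b : R) : 0 < al ->
  (surface n.+2).-integrable (sphere n.+2) (EFin \o (fun y : n.+2.-tuple R =>
    (1 - cos (a * tnth y ord0 + b * tnth y (lift ord0 ord0))) `^ al)).
Proof.
move=> al0; apply: (@integrable_sphere _ _ _ (2 `^ al)).
  by apply: measurable_one_sub_cos_pow; exact: measurable_plane_form.
by move=> y; exact: one_sub_cos_pow_le2.
Qed.

Lemma plane_G_ge0 (R : realType) n (al a b : R) : 0 <= @plane_G R n al a b.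
Proof. by apply: Rintegral_ge0 => y _; exact: powR_ge0. Qed.

(** Integrate the inequality [one_sub_cos_powD] over the sphere. *)
Lemma plane_GD (R : realType) n (al a b a' b' : R) : 0 < al ->
  @plane_G R n al (a + a') (b + b') <=
  4 `^ al * (plane_G (n := n) al a b + plane_G (n := n) al a' b').
Proof.
move=> al0; have mS := @measurable_sphere R n.+2.
have I a1 b1 := @integrable_plane_form R n al a1 b1 al0.
pose h a1 b1 (y : n.+2.-tuple R) :=
  (1 - cos (a1 * tnth y ord0 + b1 * tnth y (lift ord0 ord0))) `^ al.
have mh a1 b1 : measurable_fun setT (h a1 b1).
  by apply: measurable_one_sub_cos_pow; exact: measurable_plane_form.
have h2 a1 b1 y : 0 <= h a1 b1 y <= 2 `^ al by exact: one_sub_cos_pow_le2.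
have IhD : (surface n.+2).-integrable (sphere n.+2)
    (EFin \o (fun y => h a b y + h a' b' y)).
  apply: (@integrable_sphere _ _ _ (2 `^ al + 2 `^ al)).
    exact: measurable_funD.
  by move=> y; have := h2 a b y; have := h2 a' b' y; lra.
rewrite /plane_G -RintegralD// -RintegralZl//; apply: le_Rintegral => //.
  apply: (@integrable_sphere _ _ _ (4 `^ al * (2 `^ al + 2 `^ al))).
    apply: measurable_funM (measurable_cst _) _.
    exact: measurable_funD (mh a b) (mh a' b').
  move=> y; have := h2 a b y; have := h2 a' b' y; rewrite /h => h1 h3.
  by apply/andP; split; [apply: mulr_ge0|apply: ler_wpM2l]; rewrite ?powR_ge0//;
    lra.
move=> y _; set p := tnth y _; set q := tnth y _.
have -> : (a + a') * p + (b + b') * q = (a * p + b * q) + (a' * p + b' * q).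
  by ring.
exact: one_sub_cos_powD.
Qed.

(** Change variables by the inverse rotation: rotating the vector amounts to
rotating the sphere the other way. *)
Lemma plane_G_rotation (R : realType) n (al c s v : R) : 0 < al ->
  1 + c != 0 -> c ^+ 2 + s ^+ 2 = 1 ->
  @plane_G R n al (v * c) (v * s) = plane_G (n := n) al v 0.
Proof.
move=> al0 c1 cs; have cNs : c ^+ 2 + (- s) ^+ 2 = 1 by rewrite sqrrN.
pose U := @plane_map R n c (- - s) (- s) c.
have mU : measurable_fun setT U by exact: measurable_plane_map.
pose f (y : n.+2.-tuple R) : \bar R :=
  ((1 - cos (v * tnth y ord0 + 0 * tnth y (lift ord0 ord0))) `^ al)%:E.
have mf : measurable_fun setT f.
  apply/measurable_EFinP; apply: measurable_one_sub_cos_pow.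
  exact: measurable_plane_form.
apply: (congr1 fine).
have mS := @measurable_sphere R n.+2.
have f0 : {in sphere n.+2, forall y, 0 <= f y}%E.
  by move=> y _; rewrite lee_fin powR_ge0.
transitivity (\int[pushforward (surface n.+2) U]_(y in sphere n.+2) f y)%E.
  apply/esym; apply: (etrans (ge0_integral_pushforward mU (surface n.+2) mS
    (measurable_funS measurableT (@subsetT _ _) mf) f0)).
  rewrite (_ : U @^-1` sphere n.+2 = sphere n.+2); last first.
    by apply/seteqP; split => y; rewrite /sphere/= enorm_rotation.
  apply: eq_integral => y _; rewrite /f /= /U opprK.
  by rewrite tnth_plane_map0; congr (((1 - cos _) `^ _)%:E); ring.
by apply: eq_measure_integral => A mA _; exact: surface_rotation.
Qed.

(** Quasi-additivity applied to (1, 0) = (1/2, v s) + (1/2, - v s), where c and s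
are the cosine and sine of the angle between v e_1 and the first summand. *)
Lemma plane_G1_le (R : realType) n (al v : R) : 0 < al -> 2^-1 <= v ->
  @plane_G R n al 1 0 <= 2 * 4 `^ al * plane_G (n := n) al v 0.
Proof.
move=> al0 v2; have v0 : 0 < v by lra.
pose c := (2 * v)^-1; pose s := Num.sqrt (1 - c ^+ 2).
have c0 : 0 < c by rewrite invr_gt0; lra.
have c1 : c <= 1 by rewrite invf_le1; lra.
have cs : c ^+ 2 + s ^+ 2 = 1 by rewrite sqr_sqrtr; nra.
have vc : v * c + v * c = 1 by rewrite -mulrDr /c; field; lra.
have := @plane_GD R n al (v * c) (v * s) (v * c) (v * - s) al0.
have cn : 1 + c != 0 by lra.
rewrite !plane_G_rotation ?sqrrN// vc mulrN subrr => /le_trans; apply.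
by rewrite le_eqVlt; apply/orP; left; apply/eqP; ring.
Qed.

(** Quasi-additivity would give the constant 2 * 4 ^ al, which does not survive
iteration in [plane_G_lower]: the constant has to be exactly 4 ^ al. *)
Lemma plane_G_double (R : realType) n (al v : R) : 0 < al ->
  @plane_G R n al (2 * v) 0 <= 4 `^ al * plane_G (n := n) al v 0.
Proof.
move=> al0; have mS := @measurable_sphere R n.+2.
have I a1 b1 := @integrable_plane_form R n al a1 b1 al0.
pose h (y : n.+2.-tuple R) :=
  (1 - cos (v * tnth y ord0 + 0 * tnth y (lift ord0 ord0))) `^ al.
have mh : measurable_fun setT h.
  by apply: measurable_one_sub_cos_pow; exact: measurable_plane_form.
rewrite /plane_G -RintegralZl//.
apply: le_Rintegral => //.
  apply: (@integrable_sphere _ _ _ (4 `^ al * 2 `^ al)).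
    exact: measurable_funM (measurable_cst _) mh.
  move=> y; have /andP[h0 h2] : 0 <= h y <= 2 `^ al.
    exact: one_sub_cos_pow_le2.
  by rewrite mulr_ge0 ?powR_ge0// ler_wpM2l ?powR_ge0.
move=> y _; rewrite !mul0r !addr0; set x := v * _.
have -> : 2 * v * tnth y ord0 = x + x by rewrite /x; ring.
have x0 := one_sub_cos_ge0 x; rewrite -powRM//.
apply: ge0_ler_powR; rewrite ?nnegrE ?one_sub_cos_ge0 ?(ltW al0) ?mulr_ge0//.
by apply: le_trans (one_sub_cosD _ _) _; lra.
Qed.

(** Induction on the number k of doublings that bring v above 1/2. *)
Lemma plane_G_lower (R : realType) n (al v : R) : 0 < al -> 0 <= v ->
  @plane_G R n al 1 0 / (2 * 4 `^ al) * Num.min 1 v `^ (2 * al) <=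
  plane_G (n := n) al v 0.
Proof.
move=> al0; rewrite le_eqVlt => /predU1P[<-|v0].
  by rewrite min_r// powR0 ?mulr0 ?plane_G_ge0// mulf_neq0 ?gt_eqF.
have a4 : 0 < 4 `^ al :> R by rewrite powR_gt0.
set c := _ / _.
have c0 : 0 <= c by rewrite divr_ge0 ?plane_G_ge0// mulr_ge0// ltW.
have [k kv] : exists k, 2^-1 <= 2 ^+ k * v.
  have [k] : exists k : nat, 2^-1 / v <= k%:R.
    by exists (Num.trunc (2^-1 / v)).+1; rewrite ltW// truncnS_gt.
  rewrite ler_pdivrMr// => h; exists k; apply: le_trans h _.
  by rewrite ler_pM2r// -natrX ler_nat ltnW// ltn_expl.
have far u : 2^-1 <= u -> c * Num.min 1 u `^ (2 * al) <= plane_G (n := n) al u 0.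
  move=> u2; have m0 : 0 <= Num.min 1 u by rewrite le_min ler01; lra.
  have : c <= plane_G (n := n) al u 0.
    by rewrite /c ler_pdivrMr ?mulr_gt0// mulrC plane_G1_le.
  apply: le_trans; rewrite ler_piMr//.
  have e1 : 1 `^ (2 * al) = 1 :> R by rewrite powR1.
  rewrite -[leRHS]e1; apply: ge0_ler_powR; rewrite ?nnegrE//.
    by rewrite mulr_ge0 ?(ltW al0).
  by rewrite ge_min lexx.
elim: k v v0 kv => [|k IH] v v0 kv.
  by apply: far; move: kv; rewrite expr0 mul1r.
have [/far//|v2] := leP 2^-1 v.
have kv2 : 2^-1 <= 2 ^+ k * (2 * v) by rewrite mulrA -exprSr.
have v20 : 0 < 2 * v by rewrite mulr_gt0.
have := le_trans (IH _ v20 kv2) (plane_G_double n v al0).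
rewrite !min_r; [|lra|lra].
rewrite powRM ?(ltW v0)// powRrM (_ : 2 `^ 2 = 4).
  by rewrite mulrCA ler_pM2l.
by rewrite powR_mulrn// -natrX.
Qed.

(** The cone over the cap where y_0 >= del contains the cube [del, 2 del]^d for
del = 1 / (2 d), so the cap has positive measure; on it the integrand is at
least (1 - cos del) ^ al. *)
Lemma plane_G1_gt0 (R : realType) n (al : R) : 0 < al ->
  0 < @plane_G R n al 1 0.
Proof.
move=> al0; set d := n.+2; pose del : R := (2 * d%:R)^-1.
have del0 : 0 < del by rewrite invr_gt0 mulr_gt0.
have del1 : del <= 1 by rewrite invf_le1 ?mulr_gt0// -natrM ler1n.
have ddel : d%:R * (2 * del) = 1.
  by rewrite mulrA (mulrC d%:R) mulfV// gt_eqF// mulr_gt0.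
pose A := [set y : d.-tuple R | enorm y = 1 /\ del <= tnth y ord0].
pose f (y : d.-tuple R) : R :=
  (1 - cos (1 * tnth y ord0 + 0 * tnth y (lift ord0 ord0))) `^ al.
have mf : measurable_fun setT f.
  by apply: measurable_one_sub_cos_pow; exact: measurable_plane_form.
pose a : R := (1 - cos del) `^ al.
have pi1 : 1 <= pi :> R by have := pi_ge2 R; lra.
have a0 : 0 < a.
  rewrite powR_gt0// subr_gt0 -[ltRHS]cos0 ltr_cos// in_itv/=.
    by rewrite lexx pi_ge0.
  by rewrite ltW//=; lra.
have fa y : A y -> a <= f y.
  move=> [y1 dy]; rewrite /f mul1r mul0r addr0.
  have := norm_tnth_le y ord0; rewrite y1 ler_norml => /andP[_ yle1].
  rewrite ge0_ler_powR ?nnegrE ?one_sub_cos_ge0 ?(ltW al0)// lerD2l lerN2.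
  by rewrite leNgt ltr_cos ?in_itv/= -?leNgt//; lra.
have mA : measurable A.
  rewrite (_ : A = sphere d `&` @tnth d R ^~ ord0 @^-1` `[del, +oo[).
    apply: measurableI; first exact: measurable_sphere.
    by rewrite -[X in measurable X]setTI; apply: measurable_tnth.
  by apply/seteqP; split => y; rewrite /A /sphere /= in_itv/= andbT.
have sA : (0 < surface d A)%E.
  rewrite /surface mule_gt0 ?lte_fin//.
  apply: (@lt_le_trans _ _ (lebesgue d (cube d del (2 * del)))).
    by rewrite lebesgue_cube; [rewrite lte_fin exprn_gt0|]; lra.
  apply: le_measure; rewrite ?inE.
  - exact: measurable_cube.
  - exact: measurable_cone.
  move=> x xc.
  have x0 i : 0 <= tnth x i by have /andP[? _] := xc i; lra.
  have d0 := norm_tnth_le x ord0; rewrite ger0_norm// in d0.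
  have e0 : 0 < enorm x by have /andP[? _] := xc ord0; lra.
  have e1 : enorm x <= 1.
    rewrite /enorm -[leRHS]sqrtr1 ler_wsqrtr// /dot.
    apply: (@le_trans _ _ (\sum_(i < d) 2 * del)).
      apply: ler_sum => i _; have /andP[_ ?] := xc i; have := x0 i.
      have : 2 * del <= 1.
        have : 1 <= d%:R :> R by rewrite ler1n.
        nra.
      nra.
    by rewrite sumr_const card_ord -[leLHS]mulr_natl ddel.
  split; first by rewrite e0.
  split.
    rewrite /enorm (_ : dot _ _ = ((enorm x)^-1 * enorm x) ^+ 2).
      by rewrite mulVf ?gt_eqF// expr1n sqrtr1.
    rewrite exprMn /enorm sqr_sqrtr; last first.
      by apply: sumr_ge0 => i _; rewrite -expr2 sqr_ge0.
    rewrite /dot mulr_sumr; apply: eq_bigr => i _.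
    by rewrite !tnth_mktuple; ring.
  rewrite tnth_mktuple; have /andP[dx _] := xc ord0.
  apply: (le_trans dx); rewrite ler_peMl// invf_ge1//.
have If := @integrable_plane_form R n al 1 0 al0.
rewrite /plane_G /Rintegral fine_gt0//; apply/andP; split; last first.
  by rewrite -ge0_fin_numE ?integrable_fin_num//;
    [exact: measurable_sphere
    |apply: integral_ge0 => y _; rewrite lee_fin powR_ge0].
(* Markov's inequality on the set where f >= a. *)
apply: (@lt_le_trans _ _ (a%:E * surface d A)%E); first by rewrite mule_gt0.
have mS := @measurable_sphere R d.
have mfS : measurable_fun (sphere d) (EFin \o f).
  by apply/measurable_EFinP; exact: measurable_funS mf.
have := le_integral_abse (surface d) mS mfS a0.
rewrite (eq_integral (EFin \o f)); last first.
  by move=> y _ /=; rewrite ger0_norm ?powR_ge0.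
apply: le_trans; rewrite lee_wpmul2l ?lee_fin ?(ltW a0)//.
apply: le_measure; rewrite ?inE//; last first.
  move=> y Ay; split; first by case: Ay.
  by rewrite /= lee_fin ger0_norm ?powR_ge0// fa.
by apply: emeasurable_fun_c_infty => //; exact: measurableT_comp.
Qed.

Lemma plane_G_upper (R : realType) n (al v : R) : 0 < al -> 0 <= v ->
  @plane_G R n al v 0 <=
  2 `^ al * fine (surface n.+2 (@sphere R n.+2)) * Num.min 1 v `^ (2 * al).
Proof.
move=> al0 v0; have mS := @measurable_sphere R n.+2.
rewrite mulrAC -Rintegral_cst//.
apply: le_Rintegral => //; first exact: integrable_plane_form.
  set M := _ * _; apply: (@integrable_sphere _ _ (cst M) M (measurable_cst _)).
  by move=> y; rewrite lexx andbT mulr_ge0 ?powR_ge0.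
move=> y y1; rewrite mul0r addr0 powRrM -powRM ?powR_ge0//.
rewrite ge0_ler_powR ?nnegrE ?one_sub_cos_ge0 ?(ltW al0)//.
  by rewrite mulr_ge0 ?powR_ge0.
rewrite powR_mulrn ?le_min ?ler01//; apply: one_sub_cos_le => //.
rewrite normrM ger0_norm// ler_piMr//.
by have := norm_tnth_le y ord0; rewrite y1.
Qed.

Lemma G_bounds (R : realType) n (al : R) : 0 < al ->
  exists C1 C2 : R, [/\ 0 < C1, 0 < C2 &
     forall v : R, 0 <= v ->
       C1 * (Num.min 1 v) `^ (2 * al) <= G n.+2 al v
         <= C2 * (Num.min 1 v) `^ (2 * al)].
Proof.
move=> al0; set S := fine (surface n.+2 (@sphere R n.+2)).
have S0 : 0 <= S by rewrite fine_ge0// measure_ge0.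
have a2 : 0 < 2 `^ al :> R by rewrite powR_gt0.
have a4 : 0 < 4 `^ al :> R by rewrite powR_gt0.
exists (2 `^ al * (@plane_G R n al 1 0 / (2 * 4 `^ al))).
exists (2 `^ al * (2 `^ al * S + 1)).
split.
- by rewrite mulr_gt0// divr_gt0 ?plane_G1_gt0// mulr_gt0.
- by rewrite mulr_gt0// ltr_wpDl// mulr_ge0// ltW.
move=> v v0; rewrite G_plane_G -!mulrA !ler_pM2l// mulrA plane_G_lower//=.
apply: le_trans (plane_G_upper n al0 v0) _.
by rewrite ler_wpM2r ?powR_ge0// lerDl.
Qed.
(** * Comparison of the tails *)

(** The integral of a nonnegative function is a supremum over simple functions
below it, so it is monotone for arbitrary f and g.  The tails are compared this
way because the integrand of the Bessel tail involves G, itself an integral. *)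
Lemma ge0_le_nnintegral d (T : measurableType d) (R : realType)
    (mu : {measure set T -> \bar R}) (f g : T -> \bar R) :
  (forall x, 0 <= f x)%E -> (forall x, f x <= g x)%E ->
  (\int[mu]_x f x <= \int[mu]_x g x)%E.
Proof.
move=> f0 fg; have g0 x : (0 <= g x)%E by exact: le_trans (f0 x) (fg x).
rewrite !ge0_integralTE//; apply: le_ereal_sup => _ [h hf <-].
by exists h => // x; apply: le_trans (hf x) (fg x).
Qed.

Lemma minr_powR (R : realType) (v b : R) : 0 <= v -> 0 <= b ->
  Num.min 1 v `^ b = Num.min 1 (v `^ b).
Proof.
move=> v0 b0; have e1 : 1 `^ b = 1 :> R by rewrite powR1.
have [v1|v1] := leP 1 v.
  by rewrite powR1 min_l// -[leLHS]e1 ge0_ler_powR ?nnegrE.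
by rewrite min_r// -[leRHS]e1 ge0_ler_powR ?nnegrE// ltW.
Qed.

Lemma measurable_Cabs (R : realType) d (g : d.-tuple R -> R[i]) :
  measurable_fun setT (fun xi => complex.Re (g xi)) ->
  measurable_fun setT (fun xi => complex.Im (g xi)) ->
  measurable_fun setT (Cabs g).
Proof.
move=> mRe mIm.
rewrite (_ : Cabs g = fun xi =>
    Num.sqrt (complex.Re (g xi) ^+ 2 + complex.Im (g xi) ^+ 2)); last first.
  by apply/funext => xi; rewrite /Cabs; case: (g xi).
have msqrt : measurable_fun setT (@Num.sqrt R).
  by apply: continuous_measurable_fun; exact: sqrt_continuous.
by apply: (measurableT_comp msqrt); apply: measurable_funD;
  exact: measurable_funX.
Qed.

(** The bounds on G enclose the Bessel integral between two multiples of the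
modified one, whose integrand is visibly measurable: this is what lets the
constants C1 and C2 move through an integral. *)
Lemma tail_bounds (R : realType) n (q m : R) : 0 < q -> 0 < m ->
  exists C1 C2 : R, [/\ 0 < C1, 0 < C2 &
    forall (g : n.+2.-tuple R -> R[i]) (t : R), in_Lp q%:E g -> 0 < t ->
      (C1%:E * Bessel_tail q%:E m g t <= mod_tail q%:E m g t
         <= C2%:E * Bessel_tail q%:E m g t)%E].
Proof.
move=> q0 m0; have al0 : 0 < m * q / 2 by rewrite !mulr_gt0.
have [C1 [C2 [C10 C20 GC]]] := G_bounds n al0.
have al2 : 2 * (m * q / 2) = m * q by field.
rewrite al2 in GC.
have qV0 : 0 <= q^-1 by rewrite invr_ge0 ltW.
exists (C2^-1 `^ q^-1), (C1^-1 `^ q^-1).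
split; [by rewrite powR_gt0 ?invr_gt0|by rewrite powR_gt0 ?invr_gt0|].
move=> g t [mRe mIm _] t0.
have mq0 : 0 <= m * q by rewrite mulr_ge0 ?ltW.
pose mf xi := Num.min 1 ((enorm xi / t) `^ (m * q)) * Cabs g xi `^ q.
pose Bf xi := G n.+2 (m * q / 2) (enorm xi / t) * Cabs g xi `^ q.
have e0 (xi : n.+2.-tuple R) : 0 <= enorm xi / t.
  by rewrite divr_ge0 ?sqrtr_ge0 ?ltW.
have mf0 xi : 0 <= mf xi.
  by rewrite mulr_ge0 ?powR_ge0// le_min ler01 powR_ge0.
have mB xi : C1 * mf xi <= Bf xi <= C2 * mf xi.
  have /andP[lo hi] := GC _ (e0 xi).
  rewrite /mf /Bf -(minr_powR (e0 xi) mq0) !mulrA.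
  by rewrite !ler_wpM2r ?powR_ge0.
have mmf : measurable_fun setT (EFin \o mf).
  apply/measurable_EFinP; apply: measurable_funM.
    apply: measurable_minr => //.
    apply: (measurableT_comp (measurable_powR _)).
    by apply: measurable_funM => //; exact: measurable_enorm.
  by apply: (measurableT_comp (measurable_powR _)); exact: measurable_Cabs.
pose M := (\int[lebesgue n.+2]_xi (mf xi)%:E)%E.
pose B := (\int[lebesgue n.+2]_xi (Bf xi)%:E)%E.
have Bf0 xi : 0 <= Bf xi.
  have /andP[h _] := mB xi; apply: le_trans h.
  by rewrite mulr_ge0// ltW.
have M0 : (0 <= M)%E by apply: integral_ge0 => xi _; rewrite lee_fin.
have B0 : (0 <= B)%E by apply: integral_ge0 => xi _; rewrite lee_fin.
have scale k : 0 <= k ->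
    (\int[lebesgue n.+2]_xi (k * mf xi)%:E = k%:E * M)%E.
  move=> k0; rewrite /M -ge0_integralZl// => xi _; exact: mf0.
have lo : (C1%:E * M <= B)%E.
  rewrite -scale ?(ltW C10)//; apply: ge0_le_nnintegral => xi; rewrite lee_fin.
    by rewrite mulr_ge0// ltW.
  by have /andP[] := mB xi.
have hi : (B <= C2%:E * M)%E.
  rewrite -scale ?(ltW C20)//; apply: ge0_le_nnintegral => xi; rewrite lee_fin//.
  by have /andP[] := mB xi.
have powE k (x : \bar R) : 0 <= k -> (0 <= x)%E ->
    ((k `^ q^-1)%:E * x `^ q^-1 = (k%:E * x) `^ q^-1)%E.
  by move=> k0 x0; rewrite poweRM ?lee_fin.
have powle (x y : \bar R) : (0 <= x)%E -> (x <= y)%E ->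
    (x `^ q^-1 <= y `^ q^-1)%E.
  move=> x0 xy; apply: gt0_ler_poweR; rewrite ?in_itv/= ?leey ?andbT//.
  exact: le_trans xy.
rewrite /mod_tail /Bessel_tail -/M -/B.
apply/andP; split; rewrite powE ?invr_ge0 ?(ltW C10) ?(ltW C20)//.
  by apply: powle; rewrite ?lee_pdivrMl// mule_ge0// lee_fin invr_ge0 ltW.
by apply: powle; rewrite ?lee_pdivlMl.
Qed.

Theorem theorem1p3 (R : realType) (d : nat) (hd : (2 <= d)%N) :
  (forall alpha : R, 0 < alpha ->
     exists C1 C2 : R, [/\ 0 < C1, 0 < C2 &
       forall v : R, 0 <= v ->
         C1 * (Num.min 1 v) `^ (2 * alpha) <= G d alpha v
           <= C2 * (Num.min 1 v) `^ (2 * alpha)])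
  /\
  (forall p m : R, 1 <= p -> 0 < m ->
     exists C1 C2 : R, [/\ 0 < C1, 0 < C2 &
       forall (g : d.-tuple R -> R[i]) (t : R),
         in_Lp (conj_exp p) g -> 0 < t ->
         (C1%:E * Bessel_tail (conj_exp p) m g t
            <= mod_tail (conj_exp p) m g t
            <= C2%:E * Bessel_tail (conj_exp p) m g t)%E]).
Proof.
case: d hd => [|[|n]]// _; split; first by move=> al; exact: G_bounds.
move=> p m p1 m0; rewrite /conj_exp; case: eqVneq => [_|pN1].
  by exists 1, 1; split => // g t _ _; rewrite mul1e lexx.
apply: tail_bounds => //.
have p_gt1 : 1 < p by rewrite lt_neqAle eq_sym pN1.
by rewrite divr_gt0 ?subr_gt0// (lt_trans ltr01).
Qed.
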